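(* Let $T$ be a lobster consisting of a longest path (spine) $P=v_1v_2\cdots v_n$ of $T$ together with pendant paths of length $1$ or $2$ attached to vertices of $P$. Let $S$ be a minimum perfect critical set of $T$ such that $|S\cap S1(v_i)|\le 1$ and $|S\cap S2(v_i)|\le 1$ for every $i$. Let $v_{i_0}\in V(P)\cap S$ and $v_i\notin S$ for all $1\le i\le i_0-1$. If $p1(v_{i_0})+p2(v_{i_0})>0$ and $d(v)\ge 3$ for all $v\in S\cap V(P)$, then: (a) $p2(v_{i_0-1})\ge 1$; (b) $p1(v_{i_0})=1$ and $p2(v_{i_0})=0$; (c) $v_{i_0+1}\in S$; (d) $v_{i_0+2}\notin S$.
   Context: Graphs are finite, undirected, unweighted and simple; $d(v)$ is the degree of $v$ in $T$. A spine of a tree $T$ is a longest path in $T$. A lobster (a $2$-distant tree) is a tree with a spine $P$ such that every vertex is at distance at most $2$ from some vertex of $P$. The lobsters considered have the following structure: every vertex off the spine $P$ lies on a pendant path attached to some spine vertex $v_i$, which is either a path $v_i\,u$ of length $1$ (with $u$ of degree $1$) or a path $v_i\,u\,w$ of length $2$ (with $u$ of degree $2$ and $w$ of degree $1$), where $u,w\notin V(P)$. For a spine vertex $v_i$, $p1(v_i)$ and $p2(v_i)$ are the numbers of such pendant paths attached to $v_i$ of length $1$ and of length $2$, respectively; $S1(v_i)$ and $S2(v_i)$ are the sets of the pendant (degree $1$) end vertices of the attached paths of length $1$ and of length $2$, respectively. For a graph $G=(V,E)$, the Laplacian is $L=\Delta(G)-D(G)$, where $\Delta(G)$ is the diagonal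 matrix of vertex degrees and $D(G)$ is the $0$-$1$ adjacency matrix. For $S\subset V$ put $\overline{S}=V\setminus S$. For a vector $y$ indexed by $V$, $y_S$ denotes the vector obtained from $y$ by deleting the entries indexed by $\overline{S}$; eigenvectors are nonzero. A nonempty $S\subseteq V$ is a critical set if there is an eigenvector $y$ of $L$ with $y_{\overline{S}}=0$. A critical set $S$ is a perfect critical set if there is an eigenvector $y$ of $L$ with $y_{\overline{S}}=0$ and $y_v\neq 0$ for every $v\in S$. A perfect critical set is a minimum perfect critical set if no proper subset of it is a perfect critical set. *)

(* Defs.v *)
From HB Require Import structures.
From mathcomp Require Import all_boot all_order all_algebra.
From mathcomp Require Import reals.

Set Implicit Arguments.
Unset Strict Implicit.
Unset Printing Implicit Defensive.

Import GRing.Theory.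

Section Graph.
Variables (V : finType) (e : rel V).

Definition simple_graph : Prop := symmetric e /\ irreflexive e.

Definition deg (x : V) : nat := #|[set y | e x y]|.

(* An edge yields a [ucycle] of size 2, hence the bound on the size. *)
Definition tree : Prop :=
  [/\ simple_graph, 0 < #|V|, forall x y, connect e x y
    & forall c : seq V, 2 < size c -> ~ ucycle e c].

Definition simple_path (s : seq V) : bool := sorted e s && uniq s.

Definition spine (P : seq V) : Prop :=
  simple_path P /\ forall Q, simple_path Q -> size Q <= size P.

Definition dist_le (k : nat) (x y : V) : Prop :=
  exists s, [/\ path e x s, last x s = y & size s <= k].

Definition lobster : Prop :=
  tree /\ exists P, spine P /\ forall x, exists2 y, y \in P & dist_le 2 x y.

Section Pendant.
Variable P : seq V.

Definition pendant1 (x u : V) : bool :=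
  [&& e x u, u \notin P & deg u == 1].

(* No condition [w != x] is needed: these are used for [x] on [P] only. *)
Definition pendant2 (x u w : V) : bool :=
  [&& e x u, e u w, u \notin P, w \notin P, deg u == 2 & deg w == 1].

Definition p1 (x : V) : nat := #|[set u | pendant1 x u]|.
Definition p2 (x : V) : nat := #|[set uw : V * V | pendant2 x uw.1 uw.2]|.

Definition S1 (x : V) : {set V} := [set u | pendant1 x u].
Definition S2 (x : V) : {set V} := [set w | [exists u, pendant2 x u w]].

Definition spine_with_pendant_paths : Prop :=
  forall z, z \notin P ->
    exists2 x, x \in P &
      pendant1 x z \/ exists u w, pendant2 x u w /\ (z = u \/ z = w).

End Pendant.
End Graph.

Section Laplacian.
Local Open Scope ring_scope.
Variables (R : realType) (V : finType) (e : rel V).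

Definition degree_mx : 'M[R]_#|V| :=
  diag_mx (\row_i (deg e (enum_val i))%:R).

Definition adjacency_mx : 'M[R]_#|V| :=
  \matrix_(i, j) (e (enum_val i) (enum_val j))%:R.

Definition laplacian : 'M[R]_#|V| := degree_mx - adjacency_mx.

Definition eigenvector (A : 'M[R]_#|V|) (y : 'cV[R]_#|V|) : Prop :=
  y != 0 /\ exists a : R, A *m y = a *: y.

Definition entry (y : 'cV[R]_#|V|) (v : V) : R := y (enum_rank v) 0.

Definition critical_set (S : {set V}) : Prop :=
  S != set0 /\
  exists y, eigenvector laplacian y /\ forall v, v \in ~: S -> entry y v = 0.

Definition perfect_critical_set (S : {set V}) : Prop :=
  critical_set S /\
  exists y, [/\ eigenvector laplacian y,
                forall v, v \in ~: S -> entry y v = 0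
              & forall v, v \in S -> entry y v != 0].

Definition minimum_perfect_critical_set (S : {set V}) : Prop :=
  perfect_critical_set S /\
  forall S' : {set V}, S' \proper S -> ~ perfect_critical_set S'.

End Laplacian.

(* Main.v *)
(* Let [a] be the eigenvalue of an eigenvector [f] with support [S].  At a spine
   vertex [x] the leaf equation reads [(1 - a) f u = f x] and a pendant path
   [x u w] gives [((2 - a)(1 - a) - 1) f w = f x].  The zero vertex [v_{i0-1}]
   must have a nonzero neighbour off the spine to balance [v_{i0}], so either
   [a = 1] or [(1 - a)(2 - a) = 1].  In either case a spine vertex of [S] has
   exactly one pendant path, of known type, and its equation becomes a
   recurrence along the spine: [f_{i+1} = 2 f_i - f_{i-1}] if [a = 1], whose
   solution [0, c, 2c, ...] never vanishes and contradicts the end of the spine,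
   and [f_{i+1} = f_i - f_{i-1}] otherwise, whose solution [0, c, c, 0] is the
   claim. *)
Require Import Defs.
From mathcomp Require Import all_boot all_order all_algebra.
From mathcomp Require Import ring lra.
From mathcomp Require Import reals.

Set Implicit Arguments.
Unset Strict Implicit.
Unset Printing Implicit Defensive.

Import GRing.Theory Num.Theory.

(** * Neighbourhoods of vertices of degree 1 and 2 *)

Section Neighbours.
Variables (V : finType) (e : rel V).

Definition nbr (x : V) : {set V} := [set y | e x y].

Lemma nbr_deg1 (x y : V) : deg e x = 1 -> e x y -> nbr x = [set y].
Proof.
move=> dx exy; apply/eqP; rewrite eq_sym eqEcard cards1 sub1set inE exy /=.
by rewrite -/(deg e x) dx.
Qed.

Lemma nbr_deg2 (x y z : V) :
  deg e x = 2 -> e x y -> e x z -> y != z -> nbr x = [set y; z].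
Proof.
move=> dx exy exz yz; apply/eqP; rewrite eq_sym eqEcard cards2 yz subUset.
by rewrite !sub1set !inE exy exz /= -/(deg e x) dx.
Qed.

End Neighbours.

(** * The eigenvalue equation, vertex by vertex *)

Section LaplacianEquation.
Local Open Scope ring_scope.
Variables (R : realType) (V : finType) (e : rel V).

Definition laplacian_eq (a : R) (f : V -> R) : Prop :=
  forall v, (deg e v)%:R * f v - \sum_(u in nbr e v) f u = a * f v.

Lemma laplacian_eq_entry (a : R) (y : 'cV[R]_#|V|) :
  laplacian R e *m y = a *: y -> laplacian_eq a (entry y).
Proof.
move=> Ly v; move/matrixP/(_ (enum_rank v) 0): Ly.
rewrite mulmxBl mul_diag_mx !mxE enum_rankK => <-; congr (_ - _).
rewrite (reindex enum_rank) /=; last exact: onW_bij (enum_rank_bij V).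
rewrite big_mkcond /=; apply: eq_bigr => u _; rewrite mxE !enum_rankK inE.
by case: (e v u); rewrite ?mul1r ?mul0r.
Qed.

Variables (a : R) (f : V -> R).
Hypothesis fE : laplacian_eq a f.

Lemma laplacian_eq_leaf (u x : V) :
  deg e u = 1%N -> e u x -> (1 - a) * f u = f x.
Proof.
move=> du eux; have := fE u.
rewrite du (nbr_deg1 du eux) big_set1; lra.
Qed.

Lemma laplacian_eq_deg2 (u x w : V) :
  deg e u = 2%N -> e u x -> e u w -> x != w -> (2%:R - a) * f u = f x + f w.
Proof.
move=> du eux euw xw; have := fE u.
rewrite du (nbr_deg2 du eux euw xw) big_setU1 ?inE // big_set1 /=; lra.
Qed.

End LaplacianEquation.

(** * Neighbours of spine vertices *)

Section Spine.
Variables (V : finType) (e : rel V) (P : seq V) (x0 : V).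
Hypothesis e_tree : tree e.
Hypothesis P_spine : spine e P.
Hypothesis P_struct : spine_with_pendant_paths e P.

Let v (i : nat) : V := nth x0 P i.

Let e_sym : symmetric e. Proof. by case: e_tree => [[]]. Qed.
Let e_irr : irreflexive e. Proof. by case: e_tree => [[]]. Qed.
Let P_sorted : sorted e P. Proof. by case: P_spine => /andP[]. Qed.
Let P_uniq : uniq P. Proof. by case: P_spine => /andP[]. Qed.

Lemma spine_edge i : i.+1 < size P -> e (v i) (v i.+1).
Proof. by move=> iP; apply: (sortedP x0 _). Qed.

(** A chord would close the segment of [P] from [v i] to [v j] into a cycle on [j - i + 1 > 2]
    vertices. *)
Lemma spine_no_chord i j : i.+1 < j -> j < size P -> ~~ e (v i) (v j).
Proof.
move=> ij jP; apply/negP => eij.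
  case: e_tree => _ _ _ /(_ (take (j - i).+1 (drop i P))).
have iP : i < size P by apply: ltn_trans jP; apply: ltn_trans ij.
have sz : size (take (j - i).+1 (drop i P)) = (j - i).+1.
  by rewrite size_takel // size_drop -subSn ?leq_sub2r // ltnW // ltnW.
apply; first by rewrite sz ltnS ltn_subRL addn1.
rewrite /ucycle take_uniq ?drop_uniq // andbT.
rewrite (drop_nth x0 iP) /= rcons_path -/(v i).
have: sorted e (take (j - i).+1 (drop i P)).
  exact/take_sorted/drop_sorted.
rewrite (drop_nth x0 iP) /= => -> /=.
rewrite (last_nth x0) -[v i :: _]/(take (j - i).+1 (v i :: drop i.+1 P)).
rewrite -(drop_nth x0 iP) nth_take ?nth_drop; last first.
  by move: sz; rewrite (drop_nth x0 iP) /= => -[->].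
have -> : size (take (j - i) (drop i.+1 P)) = j - i.
  by move: sz; rewrite (drop_nth x0 iP) /= => -[->].
by rewrite subnKC ?(ltnW (ltnW ij)) // e_sym.
Qed.

Lemma spine_nbr i y :
    i < size P -> y \in P -> e (v i) y ->
  (0 < i /\ y = v i.-1) \/ (i.+1 < size P /\ y = v i.+1).
Proof.
move=> iP yP; rewrite -(nth_index x0 yP) -/(v _).
have: index y P < size P by rewrite index_mem.
move: (index y P) => j jP eij; case: (ltngtP i j) => [ij|ji|E].
- right; case: (ltngtP i.+1 j) ij => // [ij _|E _].
    by move: (spine_no_chord ij jP); rewrite eij.
  by rewrite E.
- left; case: (ltngtP j.+1 i) ji => // [ji _|E _].
    by move: (spine_no_chord ji iP); rewrite e_sym eij.
  by rewrite -E.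
- by move: eij; rewrite E e_irr.
Qed.

(** If [v i] were an end of [P], adding [z] there would give a longer path. *)
Lemma spine_end_nbr i z :
  i < size P -> e (v i) z -> z \notin P -> 0 < i /\ i.+1 < size P.
Proof.
move=> iP ez zP; case: P_spine => _ Pmax; split.
- case: i iP ez => //; rewrite /v => P0 ez; have := Pmax (z :: P).
  case: P P0 P_sorted P_uniq zP ez {Pmax} => //= x s _ xs us zP ez.
  rewrite /simple_path /= ltnn e_sym /= ez xs zP => H; exact/H.
- rewrite ltn_neqAle iP andbT; apply/eqP => iE; have := Pmax (rcons P z).
  rewrite size_rcons ltnn /simple_path rcons_uniq zP P_uniq andbT => H.
  apply: notF; apply: H.
  have {ez}: e (last x0 P) z by rewrite -nth_last -iE.
  case: P iP P_sorted {Pmax iE zP} => //= x s _ xs.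
  by rewrite andbT rcons_path xs.
Qed.

(** The pendant path containing [z] hangs at some [x'] on [P], and the degree conditions force
    [x' = x]. In the last case [z] is the far end [w], whose only neighbour is off [P], so it cannot
    be adjacent to [x]. *)
Lemma off_spine_nbr x z : x \in P -> e x z -> z \notin P ->
  pendant1 e P x z \/ exists w, pendant2 e P x z w.
Proof.
move=> xP exz zP; have [x' x'P [pz|[u [w [uw [E|E]]]]]] := P_struct zP.
- case/and3P: (pz) => ex'z _ /eqP dz; left.
  rewrite e_sym in ex'z; rewrite e_sym in exz.
  have: x \in nbr e z by rewrite inE.
  by rewrite (nbr_deg1 dz ex'z) inE => /eqP ->.
- subst z; right; exists w; case/and5P: (uw) => ex'u euw _ wP /andP[/eqP du _].
  rewrite e_sym in ex'u; rewrite e_sym in exz.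
  have x'w : x' != w by apply: contraNneq wP => <-.
  have: x \in nbr e u by rewrite inE.
  rewrite (nbr_deg2 du ex'u euw x'w) !inE => /orP[] /eqP E; first by rewrite E.
  by rewrite -E xP in wP.
- subst z; case/and5P: uw => _ euw uP _ /andP[_ /eqP dw].
  rewrite e_sym in euw; rewrite e_sym in exz.
  have: x \in nbr e w by rewrite inE.
  by rewrite (nbr_deg1 dw euw) inE => /eqP E; rewrite -E xP in uP.
Qed.

Definition off_nbr (x : V) : {set V} := nbr e x :\: [set y in P].

Lemma spine_nbrE i : 0 < i -> i.+1 < size P ->
  nbr e (v i) = v i.-1 |: (v i.+1 |: off_nbr (v i)).
Proof.
move=> i0 iP; apply/setP => y; rewrite !inE.
have i1P : i < size P by apply: ltn_trans iP.
have i2P : i.-1 < size P by apply: leq_ltn_trans i1P; apply: leq_pred.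
case: eqP => [->|n1] /=.
  by rewrite e_sym -{2}(prednK i0) spine_edge // prednK.
case: eqP => [->|n2] /=; first by rewrite spine_edge.
case: (boolP (y \in P)) => //= yP; apply/negP.
by move=> /(spine_nbr i1P yP) [] [].
Qed.

Lemma spine_neq i : 0 < i -> i.+1 < size P ->
  (v i.-1 \notin v i.+1 |: off_nbr (v i)) /\ v i.+1 \notin off_nbr (v i).
Proof.
move=> i0 iP; have i2P : i.-1 < size P.
  by apply: leq_ltn_trans iP; apply: leq_trans (leq_pred i) _.
rewrite !inE !mem_nth //= orbF nth_uniq //; split=> //.
by rewrite -(inj_eq succn_inj) prednK // -(addn2 i) -[X in X == _]addn0 eqn_add2l.
Qed.

Lemma spine_deg i : 0 < i -> i.+1 < size P ->
  deg e (v i) = #|off_nbr (v i)|.+2.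
Proof.
move=> i0 iP; have [H1 H2] := spine_neq i0 iP.
by rewrite /deg -/(nbr e (v i)) spine_nbrE // cardsU1 H1 cardsU1 H2.
Qed.

(** At most two neighbours lie on [P], so a third one lies off [P], which is impossible at an end of
    the spine. *)
Lemma spine_deg3 i : i < size P -> 3 <= deg e (v i) -> 0 < i /\ i.+1 < size P.
Proof.
move=> iP d3; case: (pickP (mem (off_nbr (v i)))) => [z|H].
  by rewrite /= !inE => /andP[zP ez]; apply: spine_end_nbr iP ez zP.
(* At an end of [P] one of these two is a junk value, which is harmless for an upper bound on the
   degree. *)
have: nbr e (v i) \subset [set v i.-1; v i.+1].
  apply/subsetP => y; rewrite !inE => ey.
  have yP : y \in P by move: (H y); rewrite /= !inE ey andbT => /negbFE.
  by case: (spine_nbr iP yP ey) => [] [_ ->]; rewrite eqxx ?orbT.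
move=> /subset_leq_card; rewrite -/(deg e (v i)) cards2 => le.
by move: (leq_trans d3 le); case: (_ != _).
Qed.

End Spine.

(** * Recurrences for an eigenvector along the spine *)

Section SpineRecurrence.
Local Open Scope ring_scope.
Variables (R : realType) (V : finType) (e : rel V) (P : seq V) (x0 : V).
Hypothesis e_tree : tree e.
Hypothesis P_spine : spine e P.
Hypothesis P_struct : spine_with_pendant_paths e P.
Variables (a : R) (f : V -> R).
Hypothesis fE : laplacian_eq e a f.

Let v (i : nat) : V := nth x0 P i.
Let e_sym : symmetric e. Proof. by case: e_tree => [[]]. Qed.

Lemma pendant1_eq x u : pendant1 e P x u -> (1 - a) * f u = f x.
Proof.
case/and3P; rewrite e_sym => eux _ /eqP du; exact: (laplacian_eq_leaf fE du eux).
Qed.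

Lemma pendant2_eq x u w : x \in P -> pendant2 e P x u w ->
  (1 - a) * f w = f u /\ (2%:R - a) * f u = f x + f w.
Proof.
move=> xP /and5P[]; rewrite e_sym => eux euw _ wP /andP[/eqP du /eqP dw].
have xw : x != w by apply: contraNneq wP => <-.
split; last exact: (laplacian_eq_deg2 fE du eux euw xw).
by apply: (laplacian_eq_leaf fE dw); rewrite e_sym.
Qed.

Lemma spine_laplacian_eq i : (0 < i)%N -> (i.+1 < size P)%N ->
  (deg e (v i))%:R * f (v i)
    - (f (v i.-1) + (f (v i.+1) + \sum_(u in off_nbr e P (v i)) f u))
  = a * f (v i).
Proof.
move=> i0 iP; have [H1 H2] := spine_neq x0 P_spine i0 iP.
by rewrite -fE spine_nbrE // !big_setU1.
Qed.

(** At a zero [x] of [f], the nonzero [f u] cancels from the pendant equations and fixes [a]. In the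
    second case the path through [u] is the one required by claim (a). *)
Lemma eigenvalue_cases x u : x \in P -> f x = 0 -> u \in off_nbr e P x ->
  f u != 0 -> a = 1 \/ (1 - a) * (2%:R - a) = 1 /\ (0 < p2 e P x)%N.
Proof.
move=> xP fx; rewrite !inE => /andP[uP exu] fu.
have [pu|[w puw]] := off_spine_nbr e_tree P_struct xP exu uP.
  left; have /eqP := pendant1_eq pu.
  by rewrite fx mulf_eq0 (negPf fu) orbF subr_eq0 => /eqP.
right; split; last by apply/card_gt0P; exists (u, w); rewrite inE.
have [Ew Eu] := pendant2_eq xP puw; rewrite fx add0r in Eu.
apply: (mulIf fu); rewrite -mulrA Eu Ew; lra.
Qed.

Variable S : {set V}.
Hypothesis fS : forall x, (x \in S) = (f x != 0).
Hypothesis S_S1 : forall x, x \in P -> (#|S :&: S1 e P x| <= 1)%N.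
Hypothesis S_S2 : forall x, x \in P -> (#|S :&: S2 e P x| <= 1)%N.
Hypothesis S_deg : forall x, x \in S -> x \in P -> (3 <= deg e x)%N.

(** Since [f x] is nonzero, the leaf equation puts every leaf at [x] into [S], so the bound on
    [S :&: S1 e P x] bounds all of them. *)
Lemma off_nbr_pendant1 x : x \in P -> x \in S ->
    (forall u w, ~~ pendant2 e P x u w) ->
  off_nbr e P x = S1 e P x /\ (#|S1 e P x| <= 1)%N.
Proof.
move=> xP; rewrite fS => fx no2; split; last first.
  apply: leq_trans (S_S1 xP); apply/subset_leq_card/subsetP => u pu.
  rewrite inE pu andbT fS; rewrite inE in pu.
  by apply: contraNneq fx => fu; rewrite -(pendant1_eq pu) fu mulr0.
apply/setP => u; rewrite !inE; apply/andP/idP => [[uP exu]|/and3P[-> ->] //].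
have [//|[w puw]] := off_spine_nbr e_tree P_struct xP exu uP.
by rewrite (negPf (no2 u w)) in puw.
Qed.

(** If [f] vanished at the end of a pendant path it would vanish at the middle vertex and then at
    [x]; so all ends lie in [S] and there is at most one. *)
Lemma off_nbr_pendant2 x : x \in P -> x \in S ->
    (forall u, ~~ pendant1 e P x u) ->
  (#|off_nbr e P x| <= 1)%N /\
  forall u, u \in off_nbr e P x -> exists w, pendant2 e P x u w.
Proof.
move=> xP; rewrite fS => fx no1.
have H u : u \in off_nbr e P x -> exists w, pendant2 e P x u w.
  rewrite !inE => /andP[uP exu].
  have [pu|//] := off_spine_nbr e_tree P_struct xP exu uP.
  by rewrite (negPf (no1 u)) in pu.
split=> //; apply/card_le1_eqP => u u' /H[w puw] /H[w' puw'].
have inS t s : pendant2 e P x t s -> s \in S :&: S2 e P x.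
  move=> pts; rewrite !inE fS; apply/andP; split; last by apply/existsP; exists t.
  apply: contraNneq fx => fs; have [Es Et] := pendant2_eq xP pts.
  by move: Et; rewrite -Es fs !mulr0 addr0 => <-.
(* Both paths end at the same leaf, whose unique neighbour is then both [u] and [u']. *)
have E : w = w' by apply: (card_le1_eqP (S_S2 xP)); apply: inS; eassumption.
subst w'; case/and5P: puw' => _; rewrite e_sym => ewu' _ _ _.
case/and5P: puw => _; rewrite e_sym => ewu _ _ /andP[_ /eqP dw].
have: u \in nbr e w by rewrite inE.
by rewrite (nbr_deg1 dw ewu') inE => /eqP.
Qed.

(** A path [x u w] at [x = v i] would give [f x + f w = (2 - a) (1 - a) f w = f w], so [f x = 0].
    Hence only leaves hang at [x], exactly one by the degree bound, and [x] has degree 3. *)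
Lemma spine_step_quadratic i : (1 - a) * (2%:R - a) = 1 ->
    (i < size P)%N -> v i \in S ->
  [/\ (i.+1 < size P)%N, p1 e P (v i) = 1%N, p2 e P (v i) = 0%N
    & f (v i.+1) = f (v i) - f (v i.-1)].
Proof.
move=> qa iP viS; have viP : v i \in P by apply: mem_nth.
have d3 := S_deg viS viP.
have [i0 i1P] := spine_deg3 e_tree P_spine iP d3.
have no2 u w : ~~ pendant2 e P (v i) u w.
  apply/negP => /(pendant2_eq viP)[Ew Eu]; move: viS; rewrite fS => /eqP; apply.
  apply: (addIr (f w)); rewrite -Eu -Ew mulrA [_ * (1 - a)]mulrC qa; lra.
have [offE le1] := off_nbr_pendant1 viP viS no2.
have sd := spine_deg x0 e_tree P_spine i0 i1P.
have cS1 : #|S1 e P (v i)| = 1%N.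
  apply/eqP; rewrite eqn_leq le1 /= -offE -ltnS -ltnS; rewrite -sd; exact: d3.
split=> //.
  apply/eqP; rewrite cards_eq0; apply/eqP/setP => -[u w].
  by rewrite !inE (negPf (no2 u w)).
have /eqP/cards1P[u S1u] := cS1.
have pu : pendant1 e P (v i) u.
  by have := set11 u; rewrite -S1u inE.
have := spine_laplacian_eq i0 i1P.
rewrite [deg e _]sd offE cS1 S1u big_set1 => E.
have := pendant1_eq pu => Eu.
(* The factor [2 - a] is the inverse of [1 - a]; with this value [a] cancels from the equation at
   [v i]. *)
have {}Eu : f u = (2%:R - a) * f (v i).
  by rewrite -Eu mulrA [_ * (1 - a)]mulrC qa mul1r.
rewrite Eu in E; lra.
Qed.

(** For [a = 1] a leaf at [v i] would force [f (v i) = 0], so a single path of length 2 hangs there.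
    Its middle vertex has value 0, by the equation at its end, and contributes only to the
    degree. *)
Lemma spine_step_one i : a = 1 -> (i < size P)%N -> v i \in S ->
  (i.+1 < size P)%N /\ f (v i.+1) = 2%:R * f (v i) - f (v i.-1).
Proof.
move=> a1 iP viS; have viP : v i \in P by apply: mem_nth.
have d3 := S_deg viS viP.
have [i0 i1P] := spine_deg3 e_tree P_spine iP d3.
have no1 u : ~~ pendant1 e P (v i) u.
  apply/negP => /pendant1_eq; rewrite a1 subrr mul0r => /esym/eqP.
  by apply/negP; rewrite -fS.
have [le1 H] := off_nbr_pendant2 viP viS no1.
have sd := spine_deg x0 e_tree P_spine i0 i1P.
have c1 : #|off_nbr e P (v i)| = 1%N.
  apply/eqP; rewrite eqn_leq le1 /= -ltnS -ltnS; rewrite -sd; exact: d3.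
split=> //; have /eqP/cards1P[u offu] := c1.
have [w puw] : exists w, pendant2 e P (v i) u w by apply: H; rewrite offu inE.
have [Ew _] := pendant2_eq viP puw.
have := spine_laplacian_eq i0 i1P; rewrite [deg e _]sd c1 offu big_set1 -Ew a1.
lra.
Qed.

Lemma eigenvalue_neq1 i : (0 < i)%N -> (i < size P)%N -> f (v i.-1) = 0 ->
  v i \in S -> a <> 1.
Proof.
move=> i0 iP f0 viS a1; have fi : f (v i) != 0 by rewrite -fS.
(* The values grow linearly, so each [v (i + k)] is again in [S] and the step applies once more;
   [k = size P] overruns the spine. *)
have H k : [/\ (i + k < size P)%N, f (v (i + k)) = k.+1%:R * f (v i)
             & f (v (i + k).-1) = k%:R * f (v i)].
  elim: k => [|k [kP E E']]; first by rewrite addn0 mul1r mul0r.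
  have kS : v (i + k) \in S by rewrite fS E mulf_neq0 // pnatr_eq0.
  have [kP' E''] := spine_step_one a1 kP kS.
  rewrite addnS; split=> //.
  by rewrite E'' E E' -(natr1 k.+1) -(natr1 k); lra.
by have [] := H (size P); rewrite ltnNge leq_addl.
Qed.

End SpineRecurrence.

(* The spine vertices v_1, ..., v_n are [tnth P 0], ..., [tnth P (n - 1)].  The
   conclusion includes that the indices i0 - 1, i0 + 1 and i0 + 2 exist. *)
Theorem theorem5 (R : realType) (V : finType) (e : rel V) (n : nat)
    (P : n.-tuple V) (S : {set V}) (i0 : 'I_n)
    (T_lobster : lobster e)
    (P_spine : spine e P)
    (T_struct : spine_with_pendant_paths e P)
    (S_min : minimum_perfect_critical_set R e S)
    (S_S1 : forall i : 'I_n, #|S :&: S1 e P (tnth P i)| <= 1)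
    (S_S2 : forall i : 'I_n, #|S :&: S2 e P (tnth P i)| <= 1)
    (i0_in : tnth P i0 \in S)
    (i0_first : forall i : 'I_n, i < i0 -> tnth P i \notin S)
    (i0_pendant : 0 < p1 e P (tnth P i0) + p2 e P (tnth P i0))
    (S_deg : forall v : V, v \in S -> v \in P -> 3 <= deg e v) :
  [/\ exists2 i : 'I_n, i.+1 = i0 & 1 <= p2 e P (tnth P i),
      p1 e P (tnth P i0) = 1 /\ p2 e P (tnth P i0) = 0,
      exists2 i : 'I_n, i = i0.+1 :> nat & tnth P i \in S
    & exists2 i : 'I_n, i = i0.+2 :> nat & tnth P i \notin S].
Proof.
have e_tree : tree e by case: T_lobster.
case: S_min => -[_ [y [[_ [a /laplacian_eq_entry fE]] y0 yn0]]] _.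
set f := entry y in fE y0 yn0.
have fS x : (x \in S) = (f x != 0%R).
  apply/idP/idP => [/yn0 //|]; apply: contraNT => xS.
  by apply/eqP/y0; rewrite inE.
(* Any vertex would do as the default of [nth]. *)
pose x0 := tnth P i0; pose v := nth x0 P.
have vE (i : 'I_n) : tnth P i = v i by apply: tnth_nth.
have S1P x : x \in P -> #|S :&: S1 e P x| <= 1 by case/tnthP => i ->.
have S2P x : x \in P -> #|S :&: S2 e P x| <= 1 by case/tnthP => i ->.
have vP i : i < n -> v i \in P by move=> ?; rewrite mem_nth ?size_tuple.
have iP : i0 < size P by rewrite size_tuple.
rewrite vE in i0_in i0_pendant *.
have [i0_gt0 i0_lt] :=
  spine_deg3 e_tree P_spine iP (S_deg _ i0_in (vP _ (ltn_ord i0))).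
rewrite size_tuple in i0_lt.
have zero k : k < i0 -> f (v k) = 0%R.
  move=> ki; have kn := ltn_trans ki (ltn_ord i0).
  have := i0_first (Ordinal kn) ki; rewrite fS negbK vE => /eqP //.
have pn : i0.-1 < n by apply: leq_ltn_trans (leq_pred _) _.
have f0 : f (v i0.-1) = 0%R by apply: zero; rewrite prednK.
(* Otherwise [v i0] is the only neighbour of [v i0.-1] where [f] can be nonzero: earlier spine
   vertices are zeros by [i0_first]. The equation at [v i0.-1] would then give [f (v i0) = 0]. *)
have [u uoff fu] : exists2 u, u \in off_nbr e P (v i0.-1) & f u != 0%R.
  apply/exists_inP; apply: contraTT i0_in; rewrite negb_exists_in fS negbK.
  move=> /forall_inP off0; have := fE (v i0.-1); rewrite f0 !mulr0 sub0r.
  rewrite (bigD1 (v i0)) /=; last first.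
    by rewrite inE -{2}(prednK i0_gt0) spine_edge // prednK // size_tuple.
  rewrite big1 ?addr0 => [/eqP|w]; first by rewrite oppr_eq0.
  rewrite inE => /andP[ew wn]; case: (boolP (w \in P)) => wP; last first.
    by apply/eqP; have := off0 w; rewrite !inE wP ew negbK => /(_ isT).
  have pP : i0.-1 < size P by rewrite size_tuple.
  have [[_ ->]|[_ E]] := spine_nbr e_tree P_spine pP wP ew.
    by apply: zero; apply: leq_ltn_trans (leq_pred _) _; rewrite prednK.
  by move: wn; rewrite E prednK // eqxx.
have := eigenvalue_cases e_tree T_struct fE (vP _ pn) f0 uoff fu.
case=> [a1|[qa p2_gt0]].
  by case: (eigenvalue_neq1 e_tree P_spine T_struct fE fS S2P S_deg i0_gt0 iP
              f0 i0_in a1).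
have step i := spine_step_quadratic e_tree P_spine T_struct fE fS S1P
  S_deg (x0 := x0) (i := i) qa.
(* Starting from the values 0 and [c] at [i0 - 1] and [i0], the first step gives [c] again, which
   keeps [v i0.+1] in [S] and permits a second step, giving [c - c = 0]. *)
have [_ p1E p2E f1] := step _ iP i0_in.
have v1S : v i0.+1 \in S by rewrite fS f1 f0 subr0 -fS.
have i1P : i0.+1 < size P by rewrite size_tuple.
have [i2P _ _ f2] := step _ i1P v1S.
rewrite size_tuple in i2P.
split=> //.
- by exists (Ordinal pn); rewrite ?prednK // vE.
- by exists (Ordinal i0_lt); rewrite // vE.
- by exists (Ordinal i2P); rewrite // vE fS f2 f1 f0 subr0 subrr eqxx.
Qed.
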